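(* For every positive integer $t$ and every $n\geq 2$, $\operatorname{im}(K_t\,\Box\, P_n)=t+1$.
   Context: All graphs are finite and simple. $K_t$ is the complete graph on $t$ vertices and $P_n$ the path on $n$ vertices. A graph $G$ has a $G'$-immersion if there is an injective map $\phi:V(G')\to V(G)$ such that for every edge $uv\in E(G')$ there is a path in $G$ joining $\phi(u)$ and $\phi(v)$, and these paths are pairwise edge-disjoint. The immersion number $\operatorname{im}(G)$ is the largest $t$ such that $G$ has a $K_t$-immersion. The Cartesian product $G\,\Box\, H$ has vertex set $V(G)\times V(H)$, with $(g,h)$ adjacent to $(g',h')$ iff $g=g'$ and $hh'\in E(H)$, or $gg'\in E(G)$ and $h=h'$. *)

(* Defs.v *)
From HB Require Import structures.
From mathcomp Require Import all_boot.
From mathcomp Require Import boolp.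

Set Implicit Arguments.
Unset Strict Implicit.
Unset Printing Implicit Defensive.

Record sgraph := SGraph {
  vertex :> finType;
  adj : rel vertex;
  adj_sym : symmetric adj;
  adj_irr : irreflexive adj }.

Definition edges (G : sgraph) : {set {set G}} :=
  [set A | [exists u : G, exists v : G, adj u v && (A == [set u; v])]].

Definition complete_rel (t : nat) : rel 'I_t := fun i j => i != j.

Lemma complete_sym (t : nat) : symmetric (@complete_rel t).
Proof. by move=> i j; rewrite /complete_rel eq_sym. Qed.

Lemma complete_irr (t : nat) : irreflexive (@complete_rel t).
Proof. by move=> i; rewrite /complete_rel eqxx. Qed.

Definition complete_graph (t : nat) : sgraph :=
  SGraph (@complete_sym t) (@complete_irr t).

Definition consecutive_rel (n : nat) : rel 'I_n :=
  fun i j => (i.+1 == j :> nat) || (j.+1 == i :> nat).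

Lemma consecutive_sym (n : nat) : symmetric (@consecutive_rel n).
Proof. by move=> i j; rewrite /consecutive_rel orbC. Qed.

Lemma consecutive_irr (n : nat) : irreflexive (@consecutive_rel n).
Proof. by move=> i; rewrite /consecutive_rel orbb eqn_leq ltnn. Qed.

(* The path on n vertices (n counts vertices, not edges). *)
Definition path_graph (n : nat) : sgraph :=
  SGraph (@consecutive_sym n) (@consecutive_irr n).

Section CartesianProduct.
Variables G H : sgraph.

Definition cartesian_rel : rel (G * H)%type := fun x y =>
  ((x.1 == y.1) && adj x.2 y.2) || (adj x.1 y.1 && (x.2 == y.2)).

Lemma cartesian_sym : symmetric cartesian_rel.
Proof.
by move=> x y; rewrite /cartesian_rel ![_ == y.1]eq_sym ![_ == y.2]eq_sym
  (adj_sym x.2) (adj_sym x.1).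
Qed.

Lemma cartesian_irr : irreflexive cartesian_rel.
Proof. by move=> x; rewrite /cartesian_rel !adj_irr andbF. Qed.

Definition cartesian_product : sgraph := SGraph cartesian_sym cartesian_irr.

End CartesianProduct.

Section Immersion.
Variable G : sgraph.

(* A path is given by the sequence of all its vertices, which are distinct. *)
Definition path_from_to (x y : G) (s : seq G) : bool :=
  if s is z :: p then [&& z == x, path (@adj G) z p, last z p == y & uniq s]
  else false.

Definition path_joining (x y : G) (s : seq G) : bool :=
  path_from_to x y s || path_from_to y x s.

Definition path_edges (s : seq G) : {set {set G}} :=
  [set [set xy.1; xy.2] | xy in zip s (behead s)].

(* P assigns one path to each (undirected) edge of H; its values outside
   edges H are irrelevant. *)
Definition has_immersion (H : sgraph) : Prop :=
  exists phi : H -> G, exists P : {set H} -> seq G,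
    [/\ injective phi,
        forall u v : H, adj u v ->
          path_joining (phi u) (phi v) (P [set u; v]) &
        forall A B : {set H}, A \in edges H -> B \in edges H -> A != B ->
          [disjoint path_edges (P A) & path_edges (P B)]].

(* The range t <= #|G| is no restriction, by injectivity of phi: see
   immersion_number_max. *)
Definition immersion_number : nat :=
  \max_(t < #|G|.+1 | `[< has_immersion (complete_graph t) >]) t.

Lemma has_immersion_immersion_number :
  has_immersion (complete_graph immersion_number).
Proof.
have h0 : `[< has_immersion (complete_graph (@ord0 #|G|)) >].
  apply/asboolP; exists (fun i : 'I_0 => False_rect G (notF (ltn_ord i))).
  exists (fun=> [::]); split; try by case.
  by move=> A B; rewrite inE => /existsP [[]].
rewrite /immersion_number (bigmax_eq_arg _ h0).
by case: arg_maxnP => // i /asboolP.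
Qed.

Lemma immersion_number_max (t : nat) :
  has_immersion (complete_graph t) -> t <= immersion_number.
Proof.
move=> ht; have lt_t : t < #|G|.+1.
  case: (ht) => phi [P [inj_phi _ _]].
  by have := leq_card phi inj_phi; rewrite card_ord.
apply: (@leq_bigmax_cond _ _ (fun i : 'I_#|G|.+1 => i : nat) (Ordinal lt_t)).
exact/asboolP.
Qed.

End Immersion.

(* Main.v *)
Require Import Defs.
From mathcomp Require Import all_boot.
From mathcomp Require Import zify.

Set Implicit Arguments.
Unset Strict Implicit.
Unset Printing Implicit Defensive.

(** Upper bound: if a [K_m]-immersion has [a] branch vertices on one side of an
    edge cut and [b] on the other, the [a * b] paths joining the two sides use
    distinct edges of the cut.  In [K_t [] P_n] consecutive layers are separated
    by [t] edges, whereas [a + b = t + 2] with [a, b >= 1] forces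
    [a * b >= t + 1].  Hence all branch vertices lie in one layer, which has
    only [t] vertices.

    Lower bound: take all vertices [(i, 0)] of the first layer and one vertex
    [(i0, 1)] of the second, joined to [(i, 0)] through [(i, 1)]. *)

Lemma set2_inj (T : finType) (a b c d : T) :
  [set a; b] = [set c; d] -> (a = c /\ b = d) \/ (a = d /\ b = c).
Proof.
move=> E.
have := set21 a b; rewrite E => /set2P ha; have := set22 a b; rewrite E => /set2P hb.
have := set21 c d; rewrite -E => /set2P hc; have := set22 c d; rewrite -E => /set2P hd.
by case: ha hb hc hd => -> [] -> [] ? [] ?; subst; auto.
Qed.

(** The crossing pair is located by splitting the [zip], since [T] is a bare [Type] without a
    membership test. *)
Lemma path_crossing (T : Type) (e : rel T) (S : pred T) (x : T) (p : seq T) :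
  path e x p -> S x != S (last x p) ->
  exists q : T * T, [/\ e q.1 q.2, S q.1 != S q.2 &
    exists s1 s2, zip (x :: p) p = s1 ++ q :: s2].
Proof.
elim: p x => [|y p IH] x /=; first by rewrite eqxx.
case/andP=> exy py hS; have [Sxy|nSxy] := eqVneq (S x) (S y).
  have [|q [eq nSq [s1 [s2 E]]]] := IH y py; first by rewrite -Sxy.
  by exists q; split=> //; exists ((x, y) :: s1), s2; rewrite E.
by exists (x, y); split=> //; exists [::], (zip (y :: p) p).
Qed.

Section Immersions.
Variable G : sgraph.

Definition edge_cut (S : pred G) : {set {set G}} :=
  [set A | [exists u : G, exists v : G,
    [&& adj u v, S u, ~~ S v & A == [set u; v]]]].

Lemma edge_cutP (S : pred G) (u v : G) :
  adj u v -> S u != S v -> [set u; v] \in edge_cut S.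
Proof.
move=> uv; rewrite inE; case Su: (S u); case Sv: (S v) => // _.
  by apply/existsP; exists u; apply/existsP; exists v; rewrite uv Su Sv /=.
apply/existsP; exists v; apply/existsP; exists u.
by rewrite adj_sym uv Su Sv setUC /=.
Qed.

Lemma path_meets_cut (S : pred G) (x y : G) (s : seq G) :
  path_joining x y s -> S x != S y ->
  exists2 A, A \in edge_cut S & A \in path_edges s.
Proof.
wlog: x y / path_from_to x y s.
  move=> W /orP [h|h] hS; first by apply: W hS => //; rewrite /path_joining h.
  by apply: (W y x) => //; rewrite 1?eq_sym // /path_joining h.
case: s => //= z p /and4P [/eqP -> pp /eqP lp _] _ hS.
have [|q [eq nSq [s1 [s2 E]]]] := @path_crossing _ (@adj G) S x p pp.
  by rewrite lp.
exists [set q.1; q.2]; first exact: edge_cutP.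
by apply/imsetP; exists q => //; rewrite [zip _ _]E mem_cat inE eqxx orbT.
Qed.

(** Each pair in [setX L (~: L)] selects a cut edge on its path. Different pairs give different
    edges of [K_m], hence edge-disjoint paths, so this selection is injective. *)
Lemma immersion_cut (m : nat) (phi : complete_graph m -> G)
    (P : {set complete_graph m} -> seq G) (S : pred G) :
  (forall u v : complete_graph m, adj u v ->
     path_joining (phi u) (phi v) (P [set u; v])) ->
  (forall A B, A \in edges (complete_graph m) ->
     B \in edges (complete_graph m) -> A != B ->
     [disjoint path_edges (P A) & path_edges (P B)]) ->
  #|[set i | S (phi i)]| * #|~: [set i | S (phi i)]| <= #|edge_cut S|.
Proof.
move=> joinP disjP; set L := [set i | _].
(* The implication, with default [set0] off [setX L (~: L)], makes the choice total, so [xchoose]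
   yields a function on all pairs. *)
have crossP (q : 'I_m * 'I_m) : exists A, (q \in setX L (~: L)) ==>
    (A \in edge_cut S) && (A \in path_edges (P [set q.1; q.2])).
  case: (boolP (q \in _)) => [|_]; last by exists set0.
  rewrite !inE => /andP [S1 S2].
  have hS : S (phi q.1) != S (phi q.2) by rewrite S1 (negbTE S2).
  have hq : @adj (complete_graph m) q.1 q.2.
    by apply: contraNneq hS => ->.
  by have [A ? ?] := path_meets_cut (joinP _ _ hq) hS; exists A; apply/andP.
have edgeP q : q \in setX L (~: L) ->
    [set q.1; q.2] \in edges (complete_graph m).
  rewrite !inE => /andP [S1 S2].
  apply/existsP; exists q.1; apply/existsP; exists q.2.
  rewrite eqxx andbT; apply: contraNneq S2 => <-; exact: S1.
pose f q := xchoose (crossP q); have fP q := xchooseP (crossP q).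
rewrite -cardsX -(@card_in_imset _ _ f).
  apply/subset_leq_card/subsetP=> _ /imsetP [q hq ->].
  by have /implyP /(_ hq) /andP [] := fP q.
move=> q r hq hr E.
have /implyP /(_ hq) /andP [_ fq] := fP q.
have /implyP /(_ hr) /andP [_ fr] := fP r.
have [/set2_inj|ne] := eqVneq [set q.1; q.2] [set r.1; r.2].
  case=> -[E1 E2]; first by case: q r E1 E2 {hq hr E fq fr} => ? ? [? ?] /= -> ->.
  (* If [q] is [r] reversed, then [q.1] lies both in [L] and in its complement. *)
  by move: hq hr; rewrite !inE E1 => /andP [S1 _] /andP [_]; rewrite S1.
have /disjoint_setI0 /setP /(_ (f q)) := disjP _ _ (edgeP _ hq) (edgeP _ hr) ne.
by rewrite !inE fq {1}E fr.
Qed.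

(* [owner x y] names the edge of [H] whose path uses the edge [xy] of [G]; its
   existence amounts to edge-disjointness. *)
Lemma has_immersion_owner (H : sgraph) (phi : H -> G) (Q : H -> H -> seq G)
    (owner : G -> G -> {set H}) :
  injective phi ->
  (forall u v, adj u v -> path_joining (phi u) (phi v) (Q u v)) ->
  (forall x y, owner x y = owner y x) ->
  (forall u v, adj u v -> forall q, q \in zip (Q u v) (behead (Q u v)) ->
     owner q.1 q.2 = [set u; v]) ->
  has_immersion G H.
Proof.
move=> inj_phi joinQ owner_sym ownerQ.
(* [P] sees only the unordered edge, so an orientation is picked; [path_joining] accepts either
   one. *)
pose P (A : {set H}) :=
  if [pick q : H * H | adj q.1 q.2 && (A == [set q.1; q.2])] is Some q
  then Q q.1 q.2 else [::].
have PE u v : adj u v ->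
    exists q : H * H, [/\ adj q.1 q.2, [set u; v] = [set q.1; q.2] &
      P [set u; v] = Q q.1 q.2].
  move=> uv; rewrite /P; case: pickP => [q /andP [aq /eqP E]|/(_ (u, v))].
    by exists q.
  by rewrite /= uv eqxx.
exists phi, P; split=> // [u v uv|A B].
  have [[a b] [/= ab /set2_inj E ->]] := PE u v uv.
  case: E => -[-> ->]; first exact: joinQ.
  by rewrite /path_joining orbC; exact: joinQ.
have ownerP (C : {set H}) x y :
    C \in edges H -> (x, y) \in zip (P C) (behead (P C)) -> owner x y = C.
  rewrite inE => /existsP [u /existsP [v /andP [uv /eqP ->]]].
  by have [q [aq -> ->]] := PE u v uv => /(ownerQ _ _ aq).
move=> hA hB; apply: contraNT => /pred0Pn [_ /andP [/imsetP [[x y] hxy ->]]].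
case/imsetP=> -[z w] hzw /= E; rewrite -(ownerP A x y) // -(ownerP B z w) //.
by case: (set2_inj E) => -[-> ->] //; rewrite owner_sym.
Qed.

End Immersions.

Section CompletePath.
Variables t n : nat.
Let G := cartesian_product (complete_graph t) (path_graph n).

(** Edges inside a layer do not cross the cut, so every cut edge is a rung from layer [k] to layer
    [k.+1], and there is one rung for each [i : 'I_t]. *)
Lemma edge_cut_layer (k : nat) :
  k.+1 < n -> #|edge_cut (fun x : G => x.2 <= k)| <= t.
Proof.
move=> lt_k; pose k0 : 'I_n := Ordinal (ltnW lt_k); pose k1 : 'I_n := Ordinal lt_k.
pose rung (i : 'I_t) : {set G} := [set ((i, k0) : G); ((i, k1) : G)].
rewrite -[leqRHS]card_ord -cardsT; apply: leq_trans (leq_imset_card rung _).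
apply/subset_leq_card/subsetP=> A; rewrite inE.
case/existsP=> -[i a] /existsP [[j b]] /and4P [+ /= ak bk /eqP ->].
rewrite /= /cartesian_rel /= => /orP [/andP [/eqP -> ab]|/andP [_ /eqP ab]]; last first.
  by rewrite -ab ak in bk.
apply/imsetP; exists j => //; rewrite /consecutive_rel in ab.
by congr [set (_, _); (_, _)]; apply: val_inj => /=; lia.
Qed.

Lemma complete_path_immersion_le (m : nat) :
  has_immersion G (complete_graph m) -> m <= t.+1.
Proof.
case=> phi [P [inj_phi joinP disjP]]; rewrite leqNgt; apply/negP=> lt_m.
have same_layer i j : (phi i).2 <= (phi j).2.
  rewrite leqNgt; apply/negP=> lt_ji.
  have := immersion_cut (fun x : G => x.2 <= (phi j).2) joinP disjP.
  set L := [set _ | _] => cutP.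
  have := leq_trans cutP (edge_cut_layer (leq_ltn_trans lt_ji (ltn_ord _))).
  have jL : 0 < #|L| by apply/card_gt0P; exists j; rewrite inE.
  have iL : 0 < #|~: L| by apply/card_gt0P; exists i; rewrite !inE -ltnNge.
  (* For [a, b >= 1], [(a - 1) * (b - 1) >= 0] gives [a * b >= a + b - 1 = m - 1 > t]. *)
  have := cardsC L; rewrite card_ord; nia.
have inj1 : injective (fun i => (phi i).1).
  move=> i j Eij; apply: inj_phi; move: Eij (same_layer i j) (same_layer j i).
  case: (phi i) (phi j) => [a b] [c d] /= -> h1 h2; congr (_, _).
  by apply: val_inj; apply/eqP; rewrite eqn_leq h1.
by have := leq_card _ inj1; rewrite !card_ord; lia.
Qed.

Lemma complete_path_immersion :
  0 < t -> 1 < n -> has_immersion G (complete_graph t.+1).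
Proof.
move=> ht hn; pose i0 : 'I_t := Ordinal ht.
pose n0 : 'I_n := Ordinal (ltnW hn); pose n1 : 'I_n := Ordinal hn.
(* [ord0] is the extra branch vertex in the second layer; [lift ord0 i] is the vertex [i] of the
   first layer. *)
pose phi (u : complete_graph t.+1) : G :=
  if unlift ord0 u is Some i then (i, n0) else (i0, n1).
(* For [i = i0] the general formula would repeat the vertex [(i0, n1)]. *)
pose detour (i : 'I_t) : seq G :=
  if i == i0 then [:: (i0, n1); (i0, n0)] else [:: (i0, n1); (i, n1); (i, n0)].
pose Q (u v : complete_graph t.+1) : seq G :=
  match unlift ord0 u, unlift ord0 v with
  | Some i, Some j => [:: (i, n0); (j, n0)]
  | None, Some i | Some i, None => detour i
  | None, None => [::]
  end.
pose lft (i : 'I_t) : complete_graph t.+1 := lift ord0 i.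
(* The cases are rungs, first-layer edges and second-layer edges. In the last, deleting [lft i0]
   leaves [ord0] and the other end of an edge at [i0], by a formula symmetric in [x] and [y]. Values
   on edges that no path uses are arbitrary. *)
pose owner (x y : G) : {set complete_graph t.+1} :=
  if x.1 == y.1 then [set (ord0 : 'I_t.+1); lft x.1]
  else if (x.2 == n0) && (y.2 == n0) then [set lft x.1; lft y.1]
  else (ord0 : 'I_t.+1) |: ([set lft x.1; lft y.1] :\ lft i0).
have lft_inj : injective lft by exact: lift_inj.
have detour_path i : path_from_to ((i0, n1) : G) (i, n0) (detour i).
  rewrite /detour; case: eqVneq => [->|ni] /=;
    rewrite /cartesian_rel /= /consecutive_rel /complete_rel //=.
  by rewrite !inE !xpair_eqE !eqxx (eq_sym i0) ni (negbTE ni) andbF.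
have detour_owner i q : q \in zip (detour i) (behead (detour i)) ->
    owner q.1 q.2 = [set (ord0 : 'I_t.+1); lft i].
  rewrite /detour; case: eqVneq => [->|ni] /=; rewrite !inE.
    by move/eqP=> -> /=; rewrite /owner eqxx.
  case/orP=> /eqP -> /=; rewrite /owner /= ?eqxx // eq_sym (negbTE ni) /=.
  congr (_ |: _); rewrite setU1K // inE eq_sym.
  by rewrite (inj_eq lft_inj).
apply: (@has_immersion_owner _ _ phi Q owner).
- move=> u v; rewrite /phi.
  by case: unliftP => [i|] ->; case: unliftP => [j|] -> // [] // ->.
- move=> u v; rewrite /phi /Q /= /complete_rel /path_joining.
  case: unliftP => [i|] ->; case: unliftP => [j|] ->; rewrite ?eqxx //= => uv.
  + rewrite (inj_eq lft_inj) in uv.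
    by rewrite /cartesian_rel /= /complete_rel !inE !xpair_eqE !eqxx (negbTE uv).
  + by rewrite detour_path orbT.
  + by rewrite detour_path.
- move=> x y; rewrite /owner eq_sym andbC [[set lft y.1; _]]setUC.
  by case: eqVneq => // ->.
- move=> u v; rewrite /Q /= /complete_rel.
  case: unliftP => [i|] ->; case: unliftP => [j|] ->; rewrite ?eqxx //= => uv q.
  + rewrite (inj_eq lft_inj) in uv.
    by rewrite inE => /eqP -> /=; rewrite /owner /= (negbTE uv).
  + by move/detour_owner ->; rewrite setUC.
  + exact: detour_owner.
Qed.

End CompletePath.

Theorem theorem12 (t n : nat) (ht : 0 < t) (hn : 2 <= n) :
  immersion_number (cartesian_product (complete_graph t) (path_graph n)) = t.+1.
Proof.
apply/eqP; rewrite eqn_leq immersion_number_max ?andbT.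
  exact/complete_path_immersion_le/has_immersion_immersion_number.
exact: complete_path_immersion.
Qed.
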